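(* $$\sum_{k=0}^{\infty}\frac{\binom{2k}{k}\binom{4k}{2k}}{128^k}\,(2H_{4k}-H_{2k})=\frac{(\log 2)\sqrt{\pi}}{2\,\Gamma(\frac{5}{8})\,\Gamma(\frac{7}{8})}.$$
   Context: For a nonnegative integer $n$, $H_n=\sum_{j=1}^{n}\frac{1}{j}$ denotes the classical harmonic number, with $H_0=0$. $\Gamma$ is the gamma function and $\log$ is the natural logarithm. *)

(* Defs.v *)
From Stdlib Require Import Reals.
From Coquelicot Require Import Coquelicot.
Open Scope R_scope.

Definition harmonic (n : nat) : R := sum_n_m (fun j : nat => 1 / INR j) 1 n.

(* Euler's integral of the second kind. [RInt_gen] is total, so the value is
   meaningful only where the improper integral converges, i.e. for [0 < x].
   The lower endpoint is approached from the right, as the integrand is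
   unbounded at 0 when [x < 1]. *)
Definition Gamma (x : R) : R :=
  RInt_gen (fun t : R => Rpower t (x - 1) * exp (- t))
    (at_right 0) (Rbar_locally p_infty).

(* Main.v *)
Require Import Defs.
From Stdlib Require Import Reals.
From Coquelicot Require Import Coquelicot.
From Stdlib Require Import Factorial Lra Lia.
Open Scope R_scope.

(** Write (x)_k for the rising factorial. The binomial factor equals
    (1/4)_k (3/4)_k / k!^2 * 2^(-k), so it is the k-th term of
    F(1/4, 3/4; 1; 1/2), where F is Gauss' hypergeometric series, and
    4 H_(4k) - 2 H_(2k) = sum over j < k of 1/(1/4 + j) + 1/(3/4 + j)
    is the logarithmic derivative of (1/4 + e)_k (3/4 + e)_k at e = 0. Hence
    twice the sum is the derivative at e = 0 of F(1/4 + e, 3/4 + e; 1; 1/2).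
    Everything below is done with (a, 1 - a) in place of (1/4, 3/4).

    Two independent facts give the value.

    First, Euler's transformation
    F(a+e, 1-a+e; 1; z) = (1-z)^(-2e) F(1-a-e, a-e; 1; z), differentiated at
    e = 0, says that the derivative series is - log(1 - z) F(a, 1-a; 1; z).
    Comparing coefficients turns this into a finite convolution identity
    ([hyp_coef_dlog]), which holds because both sides satisfy the same first
    order recurrence; no derivative in e is ever taken. At z = 1/2 Mertens'
    theorem on Cauchy products then yields the factor log 2
    ([is_series_dlog]).

    Second, F(a, 1-a; 1; 1/2) = sqrt pi / (Gamma((1+a)/2) Gamma(1 - a/2)),
    which is Bailey's theorem ([bailey_theorem]). The function
    c |-> F(a, 1-a; c; 1/2) satisfies a two-term relation between c and c + 2
    ([hyp_half_contiguous]) and tends to 1 at infinity, so its value at c = 1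
    is an infinite product of rational factors, that is, a limit of quotients
    of rising factorials. These are evaluated by Gauss' limit formula
    (x)_n Gamma(x) ~ n! n^(x-1) ([Gamma_limit]) and by Wallis' formula, which
    brings in sqrt pi ([wallis_ratio_limit]).

    Gauss' formula is obtained from Euler's integral alone: the tangent
    inequality u^x <= 1 - x + x u for 0 < x < 1, integrated against
    t^(s-1) exp(-t) with u = t/s, gives
    Gamma(s + x) <= s^x Gamma(s); used at s = n and at s = n + x, it traps Gamma(n + x) between two asymptotically equal
    bounds ([Gamma_bounds]). *)

(** * Rising factorials and the hypergeometric coefficients *)

Fixpoint rising (x : R) (n : nat) : R :=
  match n with
  | O => 1
  | S m => rising x m * (x + INR m)
  end.

Lemma rising_pos x n : 0 < x -> 0 < rising x n.
Proof.
  intros Hx; induction n as [|n IH]; simpl; [lra|].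
  pose proof (pos_INR n). apply Rmult_lt_0_compat; lra.
Qed.

Lemma rising_neq_0 x n : 0 < x -> rising x n <> 0.
Proof. intros Hx; apply Rgt_not_eq, rising_pos, Hx. Qed.

(** The recursion adds a factor at the top; this one removes the factor at
    the bottom, which is what shifting a parameter requires. *)
Lemma rising_shift x n : rising x (S n) = x * rising (x + 1) n.
Proof.
  induction n as [|n IH]; [simpl; ring|].
  change (rising x (S n) * (x + INR (S n)) = x * (rising (x + 1) n * (x + 1 + INR n))).
  rewrite IH, S_INR; ring.
Qed.

Lemma rising_1 n : rising 1 n = INR (fact n).
Proof.
  induction n as [|n IH]; [reflexivity|].
  simpl rising; rewrite IH, fact_simpl, mult_INR, S_INR; ring.
Qed.

(** The coefficient of z^k in F(a, 1-a; c; z). *)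
Definition hyp_coef (a c : R) (k : nat) : R :=
  rising a k * rising (1 - a) k / (rising c k * INR (fact k)).

Lemma hyp_coef_0 a c : hyp_coef a c 0 = 1.
Proof. unfold hyp_coef; simpl; field. Qed.

Lemma hyp_coef_S a c k : 0 < c ->
  hyp_coef a c (S k) =
  hyp_coef a c k * ((a + INR k) * (1 - a + INR k) / ((c + INR k) * INR (S k))).
Proof.
  intros Hc; unfold hyp_coef; rewrite fact_simpl, mult_INR; simpl rising.
  pose proof (rising_neq_0 c k Hc); pose proof (INR_fact_neq_0 k).
  pose proof (pos_INR k); pose proof (S_INR k).
  field; repeat split; try assumption; lra.
Qed.

Lemma hyp_coef_pos a c k : 0 < a < 1 -> 0 < c -> 0 < hyp_coef a c k.
Proof.
  intros Ha Hc; unfold hyp_coef, Rdiv.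
  pose proof (rising_pos a k); pose proof (rising_pos (1 - a) k).
  pose proof (rising_pos c k Hc); pose proof (INR_fact_lt_0 k).
  apply Rmult_lt_0_compat; [apply Rmult_lt_0_compat|apply Rinv_0_lt_compat, Rmult_lt_0_compat]; auto with real; lra.
Qed.

(** * The derivative in the parameters, as a convolution with the logarithm *)

(** Logarithmic derivative at e = 0 of (a + e)_k (1 - a + e)_k. *)
Fixpoint dlog_coef (a : R) (k : nat) : R :=
  match k with
  | O => 0
  | S m => dlog_coef a m + (1 / (a + INR m) + 1 / (1 - a + INR m))
  end.

(** Coefficient of z^(k+1) in - log(1 - z) F(a, 1-a; 1; z). *)
Definition log_conv (a : R) (k : nat) : R :=
  sum_f_R0 (fun j => hyp_coef a 1 j * / INR (S k - j)) k.

(** This is the hypergeometric differential operator applied to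
    - log(1 - z) F, read off on coefficients. Write K for S k and
    t_j for the coefficients, and split
    (K+1)^2 / (K+1-j) = (K+1+j) + j^2 / (K+1-j), and likewise
    (a+K)(1-a+K) / (K-j) = (K+1+j) + (a+j)(1-a+j) / (K-j). Since
    (a+j)(1-a+j) t_j = (j+1)^2 t_(j+1), the fractional parts cancel after a
    shift of index, and of the polynomial parts only the top term survives. *)
Lemma log_conv_rec a k : 0 < a < 1 ->
  INR (S (S k)) ^ 2 * log_conv a (S k)
  - (a + INR (S k)) * (1 - a + INR (S k)) * log_conv a k
  = (2 * INR (S k) + 1) * hyp_coef a 1 (S k).
Proof.
  intros Ha. unfold log_conv. rewrite !scal_sum.
  assert (E1 : sum_f_R0 (fun j => hyp_coef a 1 j * / INR (S (S k) - j) * INR (S (S k)) ^ 2) (S k)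
    = sum_f_R0 (fun j => (INR (S (S k)) + INR j) * hyp_coef a 1 j) (S k)
    + sum_f_R0 (fun j => INR j ^ 2 * hyp_coef a 1 j / INR (S (S k) - j)) (S k)).
  { rewrite <- plus_sum. apply sum_eq; intros j Hj.
    rewrite minus_INR, (S_INR (S k)) by lia.
    assert (INR j <= INR (S k)) by (apply le_INR; lia).
    field; lra. }
  assert (E2 : sum_f_R0 (fun j => hyp_coef a 1 j * / INR (S k - j)
                * ((a + INR (S k)) * (1 - a + INR (S k)))) k
    = sum_f_R0 (fun j => (INR (S (S k)) + INR j) * hyp_coef a 1 j) k
    + sum_f_R0 (fun j => INR (S j) ^ 2 * hyp_coef a 1 (S j) / INR (S k - j)) k).
  { rewrite <- plus_sum. apply sum_eq; intros j Hj.
    rewrite hyp_coef_S by lra. rewrite minus_INR, !S_INR by lia.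
    assert (INR j <= INR k) by (apply le_INR; lia).
    pose proof (pos_INR j). field; lra. }
  rewrite E1, E2.
  rewrite (decomp_sum (fun j => INR j ^ 2 * hyp_coef a 1 j / INR (S (S k) - j)) (S k)) by lia.
  rewrite tech5. simpl pred.
  rewrite (sum_eq (fun i => INR (S i) ^ 2 * hyp_coef a 1 (S i) / INR (S (S k) - S i))
                  (fun j => INR (S j) ^ 2 * hyp_coef a 1 (S j) / INR (S k - j)))
    by (intros; reflexivity).
  replace (INR (S (S k))) with (INR (S k) + 1) by (rewrite (S_INR (S k)); reflexivity).
  simpl (INR 0). unfold Rdiv. ring.
Qed.

(** The coefficient form of Euler's transformation, differentiated in the
    parameter. The left side obeys the recurrence of [log_conv_rec] because
    passing from k to k+1 adds 1/(a+k) + 1/(1-a+k) = (2k+1) / ((a+k)(1-a+k)). *)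
Lemma hyp_coef_dlog a k : 0 < a < 1 -> hyp_coef a 1 (S k) * dlog_coef a (S k) = log_conv a k.
Proof.
  intros Ha; induction k as [|k IH].
  - unfold log_conv; rewrite hyp_coef_S by lra. simpl. rewrite hyp_coef_0. field; lra.
  - pose proof (log_conv_rec a k Ha) as Hr. rewrite <- IH in Hr.
    pose proof (pos_INR k).
    assert (Hk : 0 < INR (S (S k))) by (apply lt_0_INR; lia).
    apply (Rmult_eq_reg_l (INR (S (S k)) ^ 2)); [|apply pow_nonzero; lra].
    replace (INR (S (S k)) ^ 2 * log_conv a (S k))
      with ((2 * INR (S k) + 1) * hyp_coef a 1 (S k)
            + (a + INR (S k)) * (1 - a + INR (S k)) * (hyp_coef a 1 (S k) * dlog_coef a (S k)))
      by lra.
    rewrite (hyp_coef_S a 1 (S k)) by lra.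
    change (dlog_coef a (S (S k))) with (dlog_coef a (S k) + (1 / (a + INR (S k)) + 1 / (1 - a + INR (S k)))).
    rewrite (S_INR (S k)) in *. rewrite S_INR in *. field; lra.
Qed.

(** * Summation at one half *)

(** The remainder of the logarithmic series has a geometric derivative, so the
    mean value theorem bounds it. *)
Lemma is_derive_log_remainder n x : 0 <= x <= 1 / 2 ->
  is_derive (fun y => - ln (1 - y) - sum_f_R0 (fun k => y ^ S k / INR (S k)) n) x
    (x ^ S n / (1 - x)).
Proof.
  intros Hx; induction n as [|n IH].
  - apply (is_derive_ext (fun y => - ln (1 - y) - y)).
    { intros t; simpl; field. }
    auto_derive; [lra|]. simpl; field; lra.
  - apply (is_derive_ext (fun y => (- ln (1 - y) - sum_f_R0 (fun k => y ^ S k / INR (S k)) n)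
             - y ^ S (S n) / INR (S (S n)))).
    { intros t; rewrite tech5; simpl; ring. }
    replace (x ^ S (S n) / (1 - x)) with (minus (x ^ S n / (1 - x)) (x ^ S n)).
    2:{ unfold minus, plus, opp; simpl; field; lra. }
    apply (is_derive_minus (K := R_AbsRing) (V := R_NormedModule)); [exact IH|].
    assert (0 < INR (S (S n))) by (apply lt_0_INR; lia).
    auto_derive; [exact I|].
    change (1 * ((INR (S n) + 1) * (x * x ^ n)) * / (INR (S n) + 1) = x ^ S n).
    rewrite (S_INR (S n)) in H. simpl (x ^ S n). field. lra.
Qed.

Lemma is_series_ln2 : is_series (fun n => / INR (S n) * (1 / 2) ^ S n) (ln 2).
Proof.
  apply is_series_Reals.
  intros eps Heps.
  destruct (pow_lt_1_zero (1/2) ltac:(rewrite Rabs_pos_eq; lra) eps Heps) as [N HN].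
  exists N; intros n Hn. unfold R_dist.
  set (phi := fun y => - ln (1 - y) - sum_f_R0 (fun k => y ^ S k / INR (S k)) n).
  destruct (MVT_gen phi 0 (1/2) (fun x => x ^ S n / (1 - x))) as [x [Hx E]].
  - intros x Hx; rewrite Rmin_left, Rmax_right in Hx by lra.
    apply is_derive_log_remainder; lra.
  - intros x Hx; rewrite Rmin_left, Rmax_right in Hx by lra.
    apply continuity_pt_filterlim.
    apply (ex_derive_continuous phi).
    eexists; apply is_derive_log_remainder; lra.
  - rewrite Rmin_left, Rmax_right in Hx by lra.
    assert (E0 : phi 0 = 0).
    { unfold phi. rewrite Rminus_0_r, ln_1.
      rewrite (sum_eq _ (fun _ => 0)). { rewrite sum_cte; ring. }
      intros i _. rewrite pow_i by lia. unfold Rdiv; ring. }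
    assert (E1 : phi (1/2) = ln 2 - sum_f_R0 (fun k => / INR (S k) * (1/2) ^ S k) n).
    { unfold phi. replace (1 - 1/2) with (/2) by lra. rewrite ln_Rinv by lra.
      rewrite Ropp_involutive. f_equal. apply sum_eq; intros i _.
      unfold Rdiv; ring. }
    rewrite E0, E1 in E.
    rewrite Rabs_minus_sym.
    replace (ln 2 - sum_f_R0 (fun k => / INR (S k) * (1/2) ^ S k) n)
      with (x ^ S n / (1 - x) * (1/2)) by lra.
    assert (0 <= x ^ S n <= (1/2) ^ S n).
    { split; [apply pow_le; lra|apply pow_incr; lra]. }
    specialize (HN (S n) ltac:(lia)). rewrite Rabs_pos_eq in HN by lra.
    assert (/ (1 - x) <= 2).
    { rewrite <- (Rinv_inv 2). apply Rinv_le_contravar; lra. }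
    assert (0 < / (1 - x)) by (apply Rinv_0_lt_compat; lra).
    unfold Rdiv at 1. rewrite Rabs_pos_eq; [|apply Rmult_le_pos; [apply Rmult_le_pos|]; lra].
    apply Rle_lt_trans with (2 := HN). nra.
Qed.

(** The successive ratios (a+k)(1-a+k) / ((c+k)(k+1)) are at most 1. *)
Lemma hyp_coef_le_1 a c k : 0 < a < 1 -> 1 <= c -> hyp_coef a c k <= 1.
Proof.
  intros Ha Hc; induction k as [|k IH]; [rewrite hyp_coef_0; lra|].
  pose proof (hyp_coef_pos a c k Ha ltac:(lra)).
  rewrite hyp_coef_S by lra. pose proof (pos_INR k). rewrite S_INR.
  assert ((a + INR k) * (1 - a + INR k) / ((c + INR k) * (INR k + 1)) <= 1).
  { apply (Rmult_le_reg_r ((c + INR k) * (INR k + 1))); [nra|].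
    unfold Rdiv; rewrite Rmult_assoc, Rinv_l by nra. nra. }
  assert (0 <= (a + INR k) * (1 - a + INR k) / ((c + INR k) * (INR k + 1))).
  { apply Rmult_le_pos; [nra|]. left; apply Rinv_0_lt_compat; nra. }
  nra.
Qed.

Lemma ex_series_half : ex_series (fun k => (1/2) ^ k).
Proof. apply ex_series_geom. rewrite Rabs_pos_eq; lra. Qed.

Lemma ex_series_hyp_coef_abs a c : 0 < a < 1 -> 1 <= c ->
  ex_series (fun k => Rabs (hyp_coef a c k * (1/2) ^ k)).
Proof.
  intros Ha Hc. apply (ex_series_le (V := R_CompleteNormedModule)) with (b := fun k => (1/2)^k).
  2: apply ex_series_half.
  intros k. unfold norm; simpl; unfold abs; simpl. rewrite Rabs_Rabsolu.
  pose proof (hyp_coef_pos a c k Ha ltac:(lra)). pose proof (hyp_coef_le_1 a c k Ha Hc).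
  pose proof (pow_lt (1/2) k ltac:(lra)).
  rewrite Rabs_pos_eq; nra.
Qed.

(** Cauchy product of F(a, 1-a; 1; 1/2) with the series of log 2. *)
Lemma is_series_dlog a : 0 < a < 1 ->
  is_series (fun k => hyp_coef a 1 k * (1/2) ^ k * dlog_coef a k)
    (ln 2 * Series (fun k => hyp_coef a 1 k * (1/2) ^ k)).
Proof.
  intros Ha.
  pose proof (ex_series_hyp_coef_abs a 1 Ha ltac:(lra)) as Hc.
  assert (Hm := is_series_mult (fun k => hyp_coef a 1 k * (1/2) ^ k)
    (fun n => / INR (S n) * (1 / 2) ^ S n) _ _
    (Series_correct _ (ex_series_Rabs _ Hc)) is_series_ln2 Hc).
  apply is_series_decr_1.
  match goal with |- is_series _ ?l =>
    replace l with (Series (fun k => hyp_coef a 1 k * (1/2) ^ k) * ln 2)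
      by (unfold plus, opp; simpl; ring) end.
  eapply is_series_ext; [|apply Hm].
  - intros k. cbv beta.
    replace (hyp_coef a 1 (S k) * (1 / 2) ^ S k * dlog_coef a (S k))
     with ((1/2) ^ S k * (hyp_coef a 1 (S k) * dlog_coef a (S k))) by ring.
    rewrite hyp_coef_dlog by assumption. unfold log_conv. rewrite scal_sum.
    apply sum_eq; intros i Hi.
    replace (S k - i)%nat with (S (k - i)) by lia.
    replace (S k) with (i + S (k - i))%nat by lia. rewrite pow_add.
    simpl; ring.
  - eapply ex_series_ext; [|exists (ln 2); apply is_series_ln2].
    intros n. rewrite Rabs_pos_eq; [reflexivity|].
    apply Rmult_le_pos; [left; apply Rinv_0_lt_compat, lt_0_INR; lia|apply pow_le; lra].
Qed.

(** * Bailey's theorem as an infinite product *)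

(** F(a, 1-a; c; 1/2). *)
Definition hyp_half (a c : R) : R := Series (fun k => hyp_coef a c k * (1 / 2) ^ k).

Lemma is_series_hyp_half a c : 0 < a < 1 -> 1 <= c ->
  is_series (fun k => hyp_coef a c k * (1 / 2) ^ k) (hyp_half a c).
Proof.
  intros Ha Hc; apply Series_correct, ex_series_Rabs, ex_series_hyp_coef_abs; assumption.
Qed.

Lemma hyp_coef_shift2 a c k : 0 < c ->
  hyp_coef a (c + 2) k = hyp_coef a c k * (c * (c + 1) / ((c + INR k) * (c + INR k + 1))).
Proof.
  intros Hc; unfold hyp_coef.
  assert (E : c * ((c + 1) * rising (c + 2) k)
              = rising c k * (c + INR k) * (c + INR k + 1)).
  { replace (c + 2) with (c + 1 + 1) by ring.
    rewrite <- !rising_shift.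
    change (rising c k * (c + INR k)) with (rising c (S k)).
    replace (c + INR k + 1) with (c + INR (S k)) by (rewrite S_INR; ring).
    reflexivity. }
  pose proof (pos_INR k). pose proof (rising_neq_0 c k Hc). pose proof (INR_fact_neq_0 k).
  pose proof (rising_neq_0 (c + 2) k ltac:(lra)).
  replace (rising c k) with (c * ((c + 1) * rising (c + 2) k) / ((c + INR k) * (c + INR k + 1)))
    by (rewrite E; field; lra).
  field; repeat split; try assumption; lra.
Qed.

(** In general the contiguous relation in c has three terms, for c, c+1 and
    c+2; the middle coefficient vanishes because z = 1/2 and the two upper
    parameters add up to 1. The proof exhibits the termwise difference of the
    two sides as a telescoping sequence. *)
Lemma hyp_half_contiguous a c : 0 < a < 1 -> 1 <= c ->
  c * (c + 1) * hyp_half a c = (c + a) * (c + 1 - a) * hyp_half a (c + 2).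
Proof.
  intros Ha Hc.
  set (u := fun k => hyp_coef a c k * (1 / 2) ^ k).
  set (v := fun k => hyp_coef a (c + 2) k * (1 / 2) ^ k).
  set (d := fun k => c * (c + 1) * u k - (c + a) * (c + 1 - a) * v k).
  (* Gosper's certificate for d: g (k + 1) - g k = d k and g 0 = 0. *)
  set (g := fun k => - 2 * (c * (c + 1)) * (u k * (INR k / (c + INR k)))).
  assert (Hd : is_series d (c * (c + 1) * hyp_half a c - (c + a) * (c + 1 - a) * hyp_half a (c + 2))).
  { exact (is_series_minus _ _ _ _
      (is_series_scal (c * (c + 1)) _ _ (is_series_hyp_half a c Ha Hc))
      (is_series_scal ((c + a) * (c + 1 - a)) _ _
        (is_series_hyp_half a (c + 2) Ha ltac:(lra)))). }
  assert (Hg : forall n, sum_n d n = g (S n)).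
  { intros n. rewrite sum_n_Reals. induction n as [|n IH].
    - simpl. unfold d, g, u, v. rewrite hyp_coef_S by lra.
      change (INR 1) with 1; simpl INR. rewrite !hyp_coef_0. simpl. field. lra.
    - rewrite tech5, IH. unfold d, g, u, v.
      rewrite hyp_coef_shift2 by lra. rewrite (hyp_coef_S a c (S n)) by lra.
      pose proof (pos_INR n).
      change ((1/2) ^ S (S n)) with (1/2 * (1/2) ^ S n).
      rewrite !(S_INR (S n)), !S_INR. match goal with |- ?x = ?y => change (x = y :> R) end. field. lra. }
  assert (H0 : is_series d 0).
  { assert (HL : is_lim_seq (fun n => g (S n)) 0).
    { apply -> (is_lim_seq_incr_1 g).
      apply is_lim_seq_abs_0.
      apply (is_lim_seq_le_le (fun _ => 0) _ (fun n => 2 * (c * (c + 1)) * (1/2) ^ n)).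
      - intros n. split; [apply Rabs_pos|].
        unfold g, u. pose proof (hyp_coef_pos a c n Ha ltac:(lra)). pose proof (hyp_coef_le_1 a c n Ha Hc).
        pose proof (pow_lt (1/2) n ltac:(lra)). pose proof (pos_INR n).
        assert (0 <= INR n / (c + INR n) <= 1).
        { split. apply Rmult_le_pos; [lra|left; apply Rinv_0_lt_compat; lra].
          apply (Rmult_le_reg_r (c + INR n)); [lra|]. unfold Rdiv; rewrite Rmult_assoc, Rinv_l; lra. }
        rewrite !Rabs_mult. replace (Rabs (-2)) with 2 by (rewrite Rabs_left; lra).
        rewrite (Rabs_pos_eq c), (Rabs_pos_eq (c + 1)) by lra.
        rewrite (Rabs_pos_eq (hyp_coef a c n)), (Rabs_pos_eq ((1/2)^n)), (Rabs_pos_eq (_ / _)) by lra.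
        apply Rmult_le_compat_l; [nra|].
        rewrite <- (Rmult_1_r ((1/2)^n)) at 2.
        apply Rmult_le_compat; try nra.
      - apply is_lim_seq_const.
      - replace (Finite 0) with (Rbar_mult (2 * (c * (c + 1))) 0) by (simpl; f_equal; ring).
        apply is_lim_seq_scal_l, is_lim_seq_geom. rewrite Rabs_pos_eq; lra. }
    unfold is_series. eapply filterlim_ext; [intros n; symmetry; apply Hg|exact HL]. }
  pose proof (is_series_unique _ _ Hd). pose proof (is_series_unique _ _ H0). lra.
Qed.

(** The first coefficient is a(1-a)/c and the coefficients decrease from
    there. The factor 1/c makes the series tend to 1 as c grows. *)
Lemma hyp_coef_S_le_inv a c k : 0 < a < 1 -> 1 <= c -> hyp_coef a c (S k) <= / c.
Proof.
  intros Ha Hc. assert (0 < / c) by (apply Rinv_0_lt_compat; lra).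
  induction k as [|k IH].
  - rewrite hyp_coef_S, hyp_coef_0 by lra. simpl.
    replace (1 * ((a + 0) * (1 - a + 0) / ((c + 0) * 1))) with (a * (1 - a) * / c) by (field; lra).
    nra.
  - refine (Rle_trans _ _ _ _ IH).
    pose proof (hyp_coef_pos a c (S k) Ha ltac:(lra)).
    rewrite (hyp_coef_S a c (S k)) by lra.
    pose proof (pos_INR k). rewrite (S_INR (S k)), S_INR.
    rewrite <- (Rmult_1_r (hyp_coef a c (S k))) at 2.
    apply Rmult_le_compat_l; [lra|].
    apply (Rmult_le_reg_r ((c + (INR k + 1)) * (INR k + 1 + 1))); [nra|].
    unfold Rdiv; rewrite Rmult_assoc, Rinv_l by nra. nra.
Qed.

Lemma hyp_half_bounds a c : 0 < a < 1 -> 1 <= c -> 1 <= hyp_half a c <= 1 + / c.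
Proof.
  intros Ha Hc. unfold hyp_half.
  pose proof (is_series_hyp_half a c Ha Hc) as Hs.
  rewrite Series_incr_1 by (eexists; exact Hs).
  rewrite hyp_coef_0. simpl ((1/2) ^ 0).
  assert (Hs1 : ex_series (fun k => hyp_coef a c (S k) * (1 / 2) ^ S k))
    by (apply -> (ex_series_incr_1 (fun k => hyp_coef a c k * (1 / 2) ^ k)); eexists; exact Hs).
  assert (Hg : is_series (fun k => / c * (1/2) * (1 / 2) ^ k) (/ c)).
  { assert (Hh : Rabs (1/2) < 1) by (rewrite Rabs_pos_eq; lra).
    pose proof (is_series_scal (/ c * (1/2)) _ _ (is_series_geom (1/2) Hh)) as Hg.
    assert (Ec : / c * (1/2) * / (1 - 1/2) = / c) by (field; lra).
    exact (eq_ind _ (is_series _) Hg _ Ec). }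
  assert (0 < / c) by (apply Rinv_0_lt_compat; lra).
  assert (forall k, 0 <= hyp_coef a c (S k) * (1 / 2) ^ S k <= / c * (1/2) * (1 / 2) ^ k).
  { intros k. pose proof (hyp_coef_pos a c (S k) Ha ltac:(lra)). pose proof (hyp_coef_S_le_inv a c k Ha Hc).
    pose proof (pow_lt (1/2) k ltac:(lra)). change ((1/2) ^ S k) with (1/2 * (1/2)^k).
    split; nra. }
  assert (Series (fun k => hyp_coef a c (S k) * (1 / 2) ^ S k) <= / c).
  { rewrite <- (is_series_unique _ _ Hg). apply Series_le; [assumption|eexists; exact Hg]. }
  assert (0 <= Series (fun k => hyp_coef a c (S k) * (1 / 2) ^ S k)).
  { rewrite <- (Rmult_0_l (Series (fun _ => 0))), <- Series_scal_l.
    apply Series_le; [|assumption]. intros k; split; [lra|]. rewrite Rmult_0_l; apply H0. }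
  lra.
Qed.

(** Written with the parameters halved, so that two factors of step 2 in c
    become one factor of step 1 in each rising factorial. *)
Definition bailey_product (a : R) (n : nat) : R :=
  rising ((1 + a) / 2) n * rising (1 - a / 2) n / (rising (1 / 2) n * INR (fact n)).

Lemma hyp_half_telescope a n : 0 < a < 1 ->
  hyp_half a 1 = bailey_product a n * hyp_half a (1 + 2 * INR n).
Proof.
  intros Ha; unfold bailey_product; induction n as [|n IH].
  - simpl. rewrite Rmult_0_r, Rplus_0_r. field.
  - rewrite IH. pose proof (pos_INR n).
    pose proof (hyp_half_contiguous a (1 + 2 * INR n) Ha ltac:(lra)) as E.
    pose proof (rising_neq_0 (1/2) n ltac:(lra)). pose proof (INR_fact_neq_0 n).
    replace (1 + 2 * INR (S n)) with (1 + 2 * INR n + 2) by (rewrite S_INR; ring).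
    replace (hyp_half a (1 + 2 * INR n)) with
     ((1 + 2 * INR n + a) * (1 + 2 * INR n + 1 - a) * hyp_half a (1 + 2 * INR n + 2)
       / ((1 + 2 * INR n) * (1 + 2 * INR n + 1))) by (rewrite <- E; field; lra).
    rewrite fact_simpl, mult_INR; simpl rising; rewrite S_INR. field. repeat split; try assumption; lra.
Qed.

Lemma bailey_product_limit a : 0 < a < 1 -> is_lim_seq (bailey_product a) (hyp_half a 1).
Proof.
  intros Ha.
  assert (HL : is_lim_seq (fun n => hyp_half a (1 + 2 * INR n)) 1).
  { apply (is_lim_seq_le_le (fun _ => 1) _ (fun n => 1 + / INR (S n))).
    - intros n. pose proof (pos_INR n).
      pose proof (hyp_half_bounds a (1 + 2 * INR n) Ha ltac:(lra)) as [H1 H2].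
      split; [exact H1|]. apply Rle_trans with (1 := H2).
      apply Rplus_le_compat_l, Rinv_le_contravar; rewrite S_INR; lra.
    - apply is_lim_seq_const.
    - replace (Finite 1) with (Finite (1 + 0)) by (f_equal; ring).
      apply is_lim_seq_plus'; [apply is_lim_seq_const|].
      apply -> (is_lim_seq_incr_1 (fun n => / INR n)).
      apply (is_lim_seq_inv _ p_infty); [apply is_lim_seq_INR|discriminate]. }
  apply (is_lim_seq_ext (fun n => hyp_half a 1 / hyp_half a (1 + 2 * INR n))).
  - intros n. pose proof (pos_INR n).
    pose proof (hyp_half_bounds a (1 + 2 * INR n) Ha ltac:(lra)).
    rewrite (hyp_half_telescope a n Ha). field. lra.
  - replace (Finite (hyp_half a 1)) with (Finite (hyp_half a 1 / 1)) by (f_equal; field).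
    apply is_lim_seq_div'; [apply is_lim_seq_const|exact HL|lra].
Qed.

(** * Wallis' integrals *)

Definition wallis (n : nat) : R := RInt (fun x => sin x ^ n) 0 (PI / 2).

Lemma ex_RInt_sin_pow n a b : ex_RInt (fun x => sin x ^ n) a b.
Proof.
  apply (ex_RInt_continuous (V := R_CompleteNormedModule)); intros x _.
  apply (ex_derive_continuous (fun x => sin x ^ n)). auto_derive; exact I.
Qed.

Lemma wallis_0 : wallis 0 = PI / 2.
Proof.
  unfold wallis. simpl. rewrite RInt_const. unfold scal; simpl; unfold mult; simpl. ring.
Qed.

Lemma wallis_1 : wallis 1 = 1.
Proof.
  apply is_RInt_unique.
  assert (E : - cos (PI / 2) - - cos 0 = 1) by (rewrite cos_PI2, cos_0; ring).
  apply (eq_ind _ (is_RInt (fun x => sin x ^ 1) 0 (PI / 2))) with (2 := E).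
  apply (is_RInt_derive (V := R_CompleteNormedModule) (fun x => - cos x) (fun x => sin x ^ 1)).
  - intros x _. auto_derive; [exact I|ring].
  - intros x _. apply (ex_derive_continuous (fun x => sin x ^ 1)). auto_derive; exact I.
Qed.

Lemma wallis_rec n : INR (S (S n)) * wallis (S (S n)) = INR (S n) * wallis n.
Proof.
  assert (H : is_RInt (fun x => INR (S (S n)) * sin x ^ S (S n) - INR (S n) * sin x ^ n)
                0 (PI / 2) 0).
  { assert (E : - cos (PI / 2) * sin (PI / 2) ^ S n - - cos 0 * sin 0 ^ S n = 0)
      by (rewrite cos_PI2, sin_0; simpl; ring).
    apply (eq_ind _ (is_RInt _ 0 (PI / 2))) with (2 := E).
    apply (is_RInt_derive (V := R_CompleteNormedModule) (fun x => - cos x * sin x ^ S n)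
      (fun x => INR (S (S n)) * sin x ^ S (S n) - INR (S n) * sin x ^ n)).
    - intros x _. auto_derive; [exact I|].
      change (match n with 0%nat => 1 | S _ => INR n + 1 end) with (INR (S n)).
      change (Init.Nat.pred (S n)) with n.
      rewrite (S_INR (S n)).
      replace (sin x ^ S (S n)) with ((1 - (cos x)²) * sin x ^ n)
        by (rewrite <- sin2; unfold Rsqr; simpl; ring).
      assert (Hs : sin x * sin x = 1 - (cos x)²) by (rewrite <- sin2; reflexivity).
      simpl pow.
      transitivity ((sin x * sin x) * sin x ^ n - cos x * cos x * INR (S n) * sin x ^ n); [ring|].
      rewrite Hs; unfold Rsqr. ring.
    - intros x _.
      apply (ex_derive_continuous (fun x => INR (S (S n)) * sin x ^ S (S n) - INR (S n) * sin x ^ n)).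
      auto_derive; tauto. }
  pose proof (is_RInt_unique (V := R_CompleteNormedModule) _ _ _ _ H) as H1.
  assert (Hw : forall k, is_RInt (V := R_NormedModule) (fun x => sin x ^ k) 0 (PI / 2) (wallis k))
    by (intros k; apply (RInt_correct (V := R_CompleteNormedModule)), ex_RInt_sin_pow).
  pose proof (is_RInt_unique (V := R_CompleteNormedModule) _ _ _ _
    (is_RInt_minus _ _ _ _ _ _
      (is_RInt_scal _ _ _ (INR (S (S n))) _ (Hw (S (S n))))
      (is_RInt_scal _ _ _ (INR (S n)) _ (Hw n)))) as H2.
  assert (H3 : 0 = INR (S (S n)) * wallis (S (S n)) - INR (S n) * wallis n)
    by (rewrite <- H1; exact H2).
  lra.
Qed.

Lemma wallis_decr n : wallis (S n) <= wallis n.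
Proof.
  pose proof PI_RGT_0. apply RInt_le; [lra|apply ex_RInt_sin_pow|apply ex_RInt_sin_pow|].
  intros x Hx. assert (0 <= sin x) by (apply sin_ge_0; lra).
  pose proof (SIN_bound x). pose proof (pow_le (sin x) n H0).
  simpl. nra.
Qed.

Lemma wallis_even n : wallis (2 * n) = PI / 2 * (rising (1 / 2) n / INR (fact n)).
Proof.
  induction n as [|n IH]; [change (2 * 0)%nat with 0%nat; rewrite wallis_0; simpl; field|].
  pose proof (wallis_rec (2 * n)) as H. rewrite IH in H.
  replace (2 * S n)%nat with (S (S (2 * n))) by lia.
  assert (E : INR (S (S (2 * n))) = 2 * (INR n + 1)) by (rewrite !S_INR, mult_INR; simpl; ring).
  assert (E' : INR (S (2 * n)) = 2 * (1/2 + INR n)) by (rewrite S_INR, mult_INR; simpl; field).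
  rewrite E, E' in H. pose proof (pos_INR n). pose proof (INR_fact_neq_0 n).
  apply (Rmult_eq_reg_l (2 * (INR n + 1))); [|lra].
  rewrite H. rewrite fact_simpl, mult_INR, S_INR. simpl rising. field. split; [assumption|lra].
Qed.

Lemma wallis_odd n : wallis (S (2 * n)) = INR (fact n) / (rising (1 / 2) n * (2 * INR n + 1)).
Proof.
  induction n as [|n IH]; [change (2 * 0)%nat with 0%nat; rewrite wallis_1; simpl; field|].
  pose proof (wallis_rec (S (2 * n))) as H. rewrite IH in H.
  replace (S (2 * S n))%nat with (S (S (S (2 * n)))) by lia.
  assert (E : INR (S (S (S (2 * n)))) = 2 * INR n + 3) by (rewrite !S_INR, mult_INR; simpl; ring).
  assert (E' : INR (S (S (2 * n))) = 2 * (INR n + 1)) by (rewrite !S_INR, mult_INR; simpl; ring).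
  rewrite E, E' in H. pose proof (pos_INR n). pose proof (rising_neq_0 (1/2) n ltac:(lra)).
  apply (Rmult_eq_reg_l (2 * INR n + 3)); [|lra].
  rewrite H. rewrite fact_simpl, mult_INR, S_INR. simpl rising. field. repeat split; try assumption; lra.
Qed.

Definition wallis_ratio (n : nat) : R := INR (fact n) / rising (1 / 2) n.

Lemma wallis_ratio_pos n : 0 < wallis_ratio n.
Proof.
  apply Rdiv_lt_0_compat; [apply INR_fact_lt_0|apply rising_pos; lra].
Qed.

(** The inequalities W_(2n+2) <= W_(2n+1) <= W_(2n) between Wallis' integrals,
    rewritten in terms of the ratio n! / (1/2)_n. *)
Lemma wallis_ratio_bounds n :
  PI * (INR n + 1 / 2) ^ 2 / (INR n + 1) <= wallis_ratio n ^ 2 <= PI * (INR n + 1 / 2).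
Proof.
  pose proof (wallis_ratio_pos n) as Hr. pose proof (pos_INR n).
  pose proof (wallis_decr (2 * n)) as H1. pose proof (wallis_decr (S (2 * n))) as H2.
  replace (S (S (2 * n))) with (2 * S n)%nat in H2 by lia.
  rewrite wallis_odd, wallis_even in H1, H2.
  pose proof (INR_fact_neq_0 n). pose proof (rising_neq_0 (1/2) n ltac:(lra)).
  replace (rising (1/2) n / INR (fact n)) with (/ wallis_ratio n) in H1
    by (unfold wallis_ratio; field; auto).
  replace (rising (1/2) (S n) / INR (fact (S n))) with ((INR n + 1/2) / (INR n + 1) * / wallis_ratio n) in H2.
  2:{ rewrite fact_simpl, mult_INR, S_INR; simpl rising. unfold wallis_ratio; field. repeat split; auto; lra. }
  replace (INR (fact n) / (rising (1/2) n * (2 * INR n + 1))) with (wallis_ratio n / (2 * INR n + 1)) in H1, H2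
    by (unfold wallis_ratio; field; split; auto; lra).
  split.
  - apply (Rmult_le_compat_r (wallis_ratio n * (2 * INR n + 1))) in H2; [|apply Rmult_le_pos; lra].
    replace (wallis_ratio n / (2 * INR n + 1) * (wallis_ratio n * (2 * INR n + 1))) with (wallis_ratio n ^ 2) in H2 by (field; lra).
    apply Rle_trans with (2 := H2). right. field. lra.
  - apply (Rmult_le_compat_r (wallis_ratio n * (2 * INR n + 1))) in H1; [|apply Rmult_le_pos; lra].
    replace (wallis_ratio n / (2 * INR n + 1) * (wallis_ratio n * (2 * INR n + 1))) with (wallis_ratio n ^ 2) in H1 by (field; lra).
    apply Rle_trans with (1 := H1). right. field. lra.
Qed.

Lemma is_lim_seq_inv_S : is_lim_seq (fun n => / INR (S n)) 0.
Proof.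
  apply -> (is_lim_seq_incr_1 (fun n => / INR n)).
  apply (is_lim_seq_inv _ p_infty); [apply is_lim_seq_INR|discriminate].
Qed.

Lemma wallis_ratio_limit : is_lim_seq (fun n => wallis_ratio (S n) / sqrt (INR (S n))) (sqrt PI).
Proof.
  apply (is_lim_seq_ext (fun n => sqrt (wallis_ratio (S n) ^ 2 / INR (S n)))).
  { intros n. assert (0 < INR (S n)) by (apply lt_0_INR; lia).
    rewrite sqrt_div_alt, sqrt_pow2 by (auto; left; apply wallis_ratio_pos). reflexivity. }
  apply (is_lim_seq_continuous sqrt).
  { apply continuity_pt_sqrt. left; apply PI_RGT_0. }
  pose proof PI_RGT_0.
  apply (is_lim_seq_le_le (fun _ => PI) _ (fun n => PI * (1 + / 2 * / INR (S n)))).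
  - intros n. destruct (wallis_ratio_bounds (S n)) as [H1 H2].
    assert (Hn : 0 < INR (S n)) by (apply lt_0_INR; lia).
    assert (Hi : 0 < / INR (S n)) by (apply Rinv_0_lt_compat; lra).
    split.
    + apply (Rmult_le_reg_r (INR (S n))); [lra|].
      replace (wallis_ratio (S n) ^ 2 / INR (S n) * INR (S n)) with (wallis_ratio (S n) ^ 2) by (field; lra).
      apply Rle_trans with (2 := H1).
      apply (Rmult_le_reg_r (INR (S n) + 1)); [lra|].
      unfold Rdiv. rewrite !Rmult_assoc, Rinv_l by lra. apply Rmult_le_compat_l; [lra|]. lra.
    + apply (Rmult_le_reg_r (INR (S n))); [lra|].
      replace (wallis_ratio (S n) ^ 2 / INR (S n) * INR (S n)) with (wallis_ratio (S n) ^ 2) by (field; lra).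
      apply Rle_trans with (1 := H2). right; field; lra.
  - apply is_lim_seq_const.
  - replace (Finite PI) with (Finite (PI * (1 + / 2 * 0))) by (f_equal; ring).
    apply is_lim_seq_mult'; [apply is_lim_seq_const|].
    apply is_lim_seq_plus'; [apply is_lim_seq_const|].
    apply is_lim_seq_mult'; [apply is_lim_seq_const|apply is_lim_seq_inv_S].
Qed.

(** * Improper integrals over the positive half line *)

(** The concave function u^x lies below its tangent at 1. With l = ln u this is
    the convex combination, with weights 1-x and x, of the inequalities
    1 + y <= exp y at y = -x l and y = (1-x) l, multiplied by exp (x l). *)
Lemma Rpower_le_tangent u x : 0 < u -> 0 < x < 1 -> Rpower u x <= 1 - x + x * u.
Proof.
  intros Hu Hx. unfold Rpower. set (l := ln u).
  rewrite <- (exp_ln u) by assumption. fold l.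
  pose proof (exp_ineq1_le (- x * l)) as H1. pose proof (exp_ineq1_le ((1 - x) * l)) as H2.
  assert (E1 : exp (x * l) * exp (- x * l) = 1)
    by (rewrite <- exp_plus; replace (x * l + - x * l) with 0 by ring; apply exp_0).
  assert (E2 : exp (x * l) * exp ((1 - x) * l) = exp l)
    by (rewrite <- exp_plus; f_equal; ring).
  pose proof (exp_pos (x * l)).
  assert (1 <= (1 - x) * exp (- x * l) + x * exp ((1 - x) * l)) by nra.
  replace (1 - x + x * exp l) with
    (exp (x * l) * ((1 - x) * exp (- x * l) + x * exp ((1 - x) * l))).
  - nra.
  - transitivity ((1 - x) * (exp (x * l) * exp (- x * l)) + x * (exp (x * l) * exp ((1 - x) * l)));
      [ring|rewrite E1, E2; ring].
Qed.

Notation half_line_int f v :=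
  (is_RInt_gen (V := R_NormedModule) f (at_right 0) (Rbar_locally p_infty) v).

Lemma filter_prod_half_line (P : R * R -> Prop) :
  (exists d M, 0 < d /\ forall a b, 0 < a < d -> M < b -> P (a, b)) ->
  filter_prod (at_right 0) (Rbar_locally p_infty) P.
Proof.
  intros (d & M & Hd & H).
  apply (Filter_prod _ _ _ (fun a => 0 < a < d) (fun b => M < b)).
  - exists (mkposreal d Hd). intros y Hy Hy0. split; [exact Hy0|].
    unfold ball in Hy; simpl in Hy; unfold AbsRing_ball, abs, minus, plus, opp in Hy; simpl in Hy.
    apply Rabs_def2 in Hy. lra.
  - exists M; auto.
  - exact H.
Qed.

Lemma filter_prod_ordered :
  filter_prod (at_right 0) (Rbar_locally p_infty) (fun ab => 0 < fst ab <= snd ab).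
Proof.
  apply filter_prod_half_line. exists 1, 1. split; [lra|]. intros; simpl; lra.
Qed.

Lemma half_line_FTC (F f : R -> R) la lb l :
  (forall t, 0 < t -> is_derive F t (f t)) ->
  (forall t, 0 < t -> continuous f t) ->
  filterlim F (at_right 0) (locally la) ->
  filterlim F (Rbar_locally p_infty) (locally lb) ->
  lb - la = l ->
  half_line_int f l.
Proof.
  intros HF Hf Ha Hb <- P HP.
  assert (HL : filterlim (fun ab => F (snd ab) - F (fst ab))
     (filter_prod (at_right 0) (Rbar_locally p_infty)) (locally (lb - la))).
  { apply (filterlim_comp_2 (G := locally lb) (H := locally (- la))
            (fun ab : R * R => F (snd ab)) (fun ab => - F (fst ab)) Rplus).
    - apply (filterlim_comp _ _ _ snd F _ (Rbar_locally p_infty)); [apply filterlim_snd|exact Hb].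
    - apply (filterlim_comp _ _ _ (fun ab => F (fst ab)) Ropp _ (locally la)).
      + apply (filterlim_comp _ _ _ fst F _ (at_right 0)); [apply filterlim_fst|exact Ha].
      + apply (filterlim_opp (V := R_NormedModule)).
    - apply (filterlim_plus (V := R_NormedModule)). }
  specialize (HL P HP). unfold filtermap in HL. unfold filtermapi.
  generalize (filter_and _ _ filter_prod_ordered HL).
  apply filter_imp. intros [a b] [Hab HPab]; simpl in *.
  exists (F b - F a); split; [|exact HPab].
  apply (is_RInt_derive (V := R_CompleteNormedModule) F f);
    intros x Hx; rewrite Rmin_left, Rmax_right in Hx by lra; [apply HF|apply Hf]; lra.
Qed.

Lemma half_line_le (f g : R -> R) lf lg :
  (forall t, 0 < t -> 0 <= f t <= g t) ->
  half_line_int f lf -> half_line_int g lg -> lf <= lg.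
Proof.
  intros Hfg Hf Hg.
  apply Rle_trans with (1 := Rle_abs lf).
  apply (RInt_gen_norm (V := R_CompleteNormedModule) (Fa := at_right 0) (Fb := Rbar_locally p_infty) f g lf lg); auto.
  - generalize filter_prod_ordered; apply filter_imp; intros ab Hab; lra.
  - generalize filter_prod_ordered; apply filter_imp; intros ab Hab x Hx.
    specialize (Hfg x ltac:(lra)). unfold norm; simpl; unfold abs; simpl.
    rewrite Rabs_pos_eq; lra.
Qed.

Lemma half_line_ext (f g : R -> R) l :
  (forall t, 0 < t -> f t = g t) -> half_line_int f l -> half_line_int g l.
Proof.
  intros Hfg. apply is_RInt_gen_ext.
  generalize filter_prod_ordered; apply filter_imp; intros ab Hab x Hx.
  apply Hfg. rewrite Rmin_left in Hx; lra.
Qed.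

(** The integrals over compact subintervals increase with the interval, so
    they converge to their supremum. *)
Lemma half_line_ex (f : R -> R) (M : R) :
  (forall t, 0 < t -> 0 <= f t) ->
  (forall t, 0 < t -> continuous f t) ->
  (forall a b, 0 < a <= b -> RInt f a b <= M) ->
  exists l, half_line_int f l.
Proof.
  intros Hpos Hc HM.
  assert (Hex : forall a b, 0 < a <= b -> ex_RInt f a b).
  { intros a b Hab. apply (ex_RInt_continuous (V := R_CompleteNormedModule)).
    intros z Hz; rewrite Rmin_left in Hz by lra; apply Hc; lra. }
  assert (Hmono : forall a b a' b', 0 < a' <= a -> a <= b -> b <= b' -> RInt f a b <= RInt f a' b').
  { intros a b a' b' Ha Hab Hb.
    rewrite <- (RInt_Chasles f a' a b'), <- (RInt_Chasles f a b b') by (apply Hex; lra).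
    assert (0 <= RInt f a' a).
    { apply RInt_ge_0; [lra|apply Hex; lra|intros; apply Hpos; lra]. }
    assert (0 <= RInt f b b').
    { apply RInt_ge_0; [lra|apply Hex; lra|intros; apply Hpos; lra]. }
    unfold plus; simpl. lra. }
  destruct (completeness (fun v => exists a b, 0 < a <= b /\ v = RInt f a b)) as [l [Hub Hlub]].
  - exists M. intros v (a & b & Hab & ->). auto.
  - exists (RInt f 1 1), 1, 1; split; [lra|reflexivity].
  - exists l. intros P [eps HP].
    assert (H0 : exists a b, 0 < a <= b /\ l - eps < RInt f a b).
    { destruct (Classical_Prop.classic (exists a b, 0 < a <= b /\ l - eps < RInt f a b)) as [H|H]; [exact H|].
      exfalso. pose proof (cond_pos eps).
      assert (l <= l - eps); [|lra]. apply Hlub. intros v (a & b & Hab & ->).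
      apply Rnot_lt_le. intros Hlt. apply H. exists a, b. auto. }
    destruct H0 as (a0 & b0 & Hab & Hlt).
    unfold filtermapi. apply filter_prod_half_line. exists a0, b0. split; [lra|].
    intros a b Ha Hb. exists (RInt f a b). split.
    + apply (RInt_correct (V := R_CompleteNormedModule)), Hex. simpl; lra.
    + apply HP. unfold ball; simpl; unfold AbsRing_ball, abs, minus, plus, opp; simpl.
      assert (RInt f a b <= l) by (apply Hub; exists a, b; split; [lra|reflexivity]).
      pose proof (Hmono a0 b0 a b ltac:(lra) ltac:(lra) ltac:(lra)).
      pose proof (cond_pos eps). apply Rabs_def1; lra.
Qed.

(** * Euler's integral: recurrence and growth *)

Definition gamma_integrand (s t : R) : R := Rpower t (s - 1) * exp (- t).

Lemma gamma_integrand_pos s t : 0 < gamma_integrand s t.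
Proof. apply Rmult_lt_0_compat; apply exp_pos. Qed.

Lemma gamma_integrand_continuous s t : 0 < t -> continuous (gamma_integrand s) t.
Proof.
  intros Ht. apply (ex_derive_continuous (gamma_integrand s)).
  unfold gamma_integrand, Rpower. auto_derive. tauto.
Qed.

Lemma gamma_integrand_S s t : 0 < t -> gamma_integrand (s + 1) t = t * gamma_integrand s t.
Proof.
  intros Ht; unfold gamma_integrand.
  replace (s + 1 - 1) with (s - 1 + 1) by ring.
  rewrite Rpower_plus, Rpower_1 by assumption; ring.
Qed.

Lemma gamma_integrand_derive s t : 0 < t ->
  is_derive (gamma_integrand (s + 1)) t (s * gamma_integrand s t - gamma_integrand (s + 1) t).
Proof.
  intros Ht. rewrite gamma_integrand_S by assumption.
  apply (is_derive_ext (fun t => exp (s * ln t) * exp (- t))).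
  { intros u. unfold gamma_integrand, Rpower. do 3 f_equal; ring. }
  auto_derive; [assumption|].
  unfold gamma_integrand, Rpower.
  replace (exp (s * ln t)) with (t * exp ((s - 1) * ln t)).
  2:{ rewrite <- (exp_ln t) at 1 by assumption. rewrite <- exp_plus; f_equal; ring. }
  field; lra.
Qed.

Lemma gamma_integrand_lim_0 s : 0 < s ->
  filterlim (gamma_integrand (s + 1)) (at_right 0) (locally 0).
Proof.
  intros Hs. apply filterlim_locally. intros eps. pose proof (cond_pos eps) as He.
  exists (mkposreal (Rpower eps (/ s)) (exp_pos _)). intros t Ht Ht0.
  unfold ball in *; simpl in *; unfold AbsRing_ball, abs, minus, plus, opp in *; simpl in *.
  rewrite Ropp_0, Rplus_0_r in *. rewrite Rabs_pos_eq in Ht by lra.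
  pose proof (gamma_integrand_pos (s + 1) t). rewrite Rabs_pos_eq by lra.
  unfold gamma_integrand. replace (s + 1 - 1) with s by ring.
  assert (Rpower t s < eps).
  { rewrite <- (Rpower_1 eps) by assumption. replace 1 with (/ s * s) by (field; lra).
    rewrite <- Rpower_mult. apply Rlt_Rpower_l; [assumption|lra]. }
  assert (exp (- t) < 1) by (rewrite <- exp_0; apply exp_increasing; lra).
  pose proof (exp_pos (- t)). assert (0 < Rpower t s) by apply exp_pos. nra.
Qed.

(** From ln u <= u - 1 at u = t / (2s) one gets
    s ln t - t <= s ln (2s) - t/2. *)
Lemma gamma_integrand_lim_infty s : 0 < s ->
  filterlim (gamma_integrand (s + 1)) (Rbar_locally p_infty) (locally 0).
Proof.
  intros Hs. apply filterlim_locally. intros eps. pose proof (cond_pos eps) as He.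
  exists (Rmax 0 (2 * (s * ln (2 * s) - ln eps))). intros t Ht.
  pose proof (Rmax_l 0 (2 * (s * ln (2 * s) - ln eps))).
  pose proof (Rmax_r 0 (2 * (s * ln (2 * s) - ln eps))).
  unfold ball in *; simpl in *; unfold AbsRing_ball, abs, minus, plus, opp in *; simpl in *.
  rewrite Ropp_0, Rplus_0_r in *.
  pose proof (gamma_integrand_pos (s + 1) t). rewrite Rabs_pos_eq by lra.
  unfold gamma_integrand, Rpower. replace (s + 1 - 1) with s by ring.
  rewrite <- exp_plus. rewrite <- (exp_ln eps) by assumption.
  apply exp_increasing.
  assert (Hu : 0 < t / (2 * s)) by (apply Rdiv_lt_0_compat; lra).
  pose proof (exp_ineq1_le (ln (t / (2 * s)))) as Hl. rewrite exp_ln in Hl by assumption.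
  unfold Rdiv in Hl at 1. rewrite ln_mult, ln_Rinv in Hl by (try apply Rinv_0_lt_compat; lra).
  assert (s * (1 + (ln t + - ln (2 * s))) <= s * (t / (2 * s))) by (apply Rmult_le_compat_l; lra).
  replace (s * (t / (2 * s))) with (t / 2) in H2 by (field; lra).
  lra.
Qed.

Lemma gamma_by_parts s : 0 < s ->
  half_line_int (fun t => s * gamma_integrand s t - gamma_integrand (s + 1) t) 0.
Proof.
  intros Hs. apply (half_line_FTC (gamma_integrand (s + 1)) _ 0 0); [| | | |ring].
  - intros t Ht; apply gamma_integrand_derive, Ht.
  - intros t Ht. apply (continuous_minus (V := R_NormedModule)).
    + apply (continuous_scal_r (V := R_NormedModule)), gamma_integrand_continuous, Ht.
    + apply gamma_integrand_continuous, Ht.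
  - apply gamma_integrand_lim_0, Hs.
  - apply gamma_integrand_lim_infty, Hs.
Qed.

Lemma gamma_int_S s v : 0 < s ->
  half_line_int (gamma_integrand s) v -> half_line_int (gamma_integrand (s + 1)) (s * v).
Proof.
  intros Hs Hv. replace (s * v) with (minus (scal s v) 0).
  2:{ unfold minus, plus, opp, scal; simpl; unfold mult; simpl; ring. }
  eapply half_line_ext; [|exact (is_RInt_gen_minus _ _ _ _ (is_RInt_gen_scal _ s _ Hv) (gamma_by_parts s Hs))].
  intros t _. unfold minus, plus, opp, scal; simpl; unfold mult; simpl; ring.
Qed.

(** The recurrence read downwards: existence at s follows from existence at
    s + 1, so the singularity at 0 for s < 1 never has to be estimated. *)
Lemma gamma_int_pred s v : 0 < s ->
  half_line_int (gamma_integrand (s + 1)) v -> half_line_int (gamma_integrand s) (v / s).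
Proof.
  intros Hs Hv. replace (v / s) with (scal (/ s) (plus 0 v)).
  2:{ unfold plus, scal; simpl; unfold mult; simpl; field; lra. }
  eapply half_line_ext; [|exact (is_RInt_gen_scal _ (/ s) _ (is_RInt_gen_plus _ _ _ _ (gamma_by_parts s Hs) Hv))].
  intros t _. unfold plus, scal; simpl; unfold mult; simpl; field; lra.
Qed.

Lemma gamma_int_1 : half_line_int (gamma_integrand 1) 1.
Proof.
  apply (half_line_ext (fun t => exp (- t))).
  { intros t Ht. unfold gamma_integrand. rewrite Rminus_diag, Rpower_O by assumption. ring. }
  apply (half_line_FTC (fun t => - exp (- t)) _ (- 1) 0); [| | | |ring].
  - intros t _. auto_derive; [exact I|ring].
  - intros t _. apply (ex_derive_continuous (fun t => exp (- t))). auto_derive; exact I.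
  - assert (H : filterlim (fun t => - exp (- t)) (locally 0) (locally (- exp (- 0)))).
    { apply (ex_derive_continuous (fun t => - exp (- t))). auto_derive; exact I. }
    rewrite Ropp_0, exp_0 in H.
    intros P HP. apply filter_le_within, H, HP.
  - apply filterlim_locally. intros eps. pose proof (cond_pos eps) as He.
    exists (- ln eps). intros t Ht.
    unfold ball in *; simpl in *; unfold AbsRing_ball, abs, minus, plus, opp in *; simpl in *.
    rewrite Ropp_0, Rplus_0_r, Rabs_Ropp. pose proof (exp_pos (- t)). rewrite Rabs_pos_eq by lra.
    rewrite <- (exp_ln eps) by assumption. apply exp_increasing. lra.
Qed.

(** At x + 1 the integrand is bounded by (1 + t) exp(-t), which has the
    antiderivative - (2 + t) exp(-t); then descend to x. *)
Lemma gamma_int_ex x : 0 < x < 1 -> exists v, half_line_int (gamma_integrand x) v.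
Proof.
  intros Hx.
  destruct (half_line_ex (gamma_integrand (x + 1)) 2) as [v Hv].
  - intros t _; left; apply gamma_integrand_pos.
  - intros t Ht; apply gamma_integrand_continuous, Ht.
  - intros a b Hab.
    assert (HI : is_RInt (fun t => (1 + t) * exp (- t)) a b
              (minus (- (2 + b) * exp (- b)) (- (2 + a) * exp (- a)))).
    { apply (is_RInt_derive (V := R_CompleteNormedModule) (fun t => - (2 + t) * exp (- t))).
      - intros t _. auto_derive; [exact I|ring].
      - intros t _. apply (ex_derive_continuous (fun t => (1 + t) * exp (- t))). auto_derive; exact I. }
    apply Rle_trans with (RInt (fun t => (1 + t) * exp (- t)) a b).
    + apply RInt_le; [lra| |eexists; exact HI|].
      * apply (ex_RInt_continuous (V := R_CompleteNormedModule)).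
        intros z Hz; rewrite Rmin_left in Hz by lra; apply gamma_integrand_continuous; lra.
      * intros t Ht. unfold gamma_integrand. replace (x + 1 - 1) with x by ring.
        apply Rmult_le_compat_r; [left; apply exp_pos|].
        pose proof (Rpower_le_tangent t x ltac:(lra) Hx). nra.
    + rewrite (is_RInt_unique _ _ _ _ HI). unfold minus, plus, opp; simpl.
      pose proof (exp_pos (- b)).
      (* 1 + a/2 <= exp (a/2) <= exp a. *)
      assert ((2 + a) * exp (- a) <= 2).
      { pose proof (exp_ineq1_le (a / 2)) as H1.
        assert (E : exp (a / 2) * exp (- a) = exp (- (a / 2))) by (rewrite <- exp_plus; f_equal; field).
        assert (exp (- (a / 2)) <= 1) by (rewrite <- exp_0; left; apply exp_increasing; lra).
        pose proof (exp_pos (- a)). nra. }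
      nra.
  - exists (v / x). apply gamma_int_pred; [lra|exact Hv].
Qed.

Lemma gamma_int_Gamma x : 0 < x < 1 -> half_line_int (gamma_integrand x) (Gamma x).
Proof.
  intros Hx. apply (RInt_gen_correct (V := R_CompleteNormedModule)).
  destruct (gamma_int_ex x Hx) as [v Hv]. exists v; exact Hv.
Qed.

Lemma gamma_int_rising x v n : 0 < x ->
  half_line_int (gamma_integrand x) v ->
  half_line_int (gamma_integrand (x + INR n)) (rising x n * v).
Proof.
  intros Hx Hv; induction n as [|n IH].
  - simpl. rewrite Rplus_0_r, Rmult_1_l; exact Hv.
  - rewrite S_INR. replace (x + (INR n + 1)) with (x + INR n + 1) by ring.
    replace (rising x (S n) * v) with ((x + INR n) * (rising x n * v)) by (simpl; ring).
    apply gamma_int_S; [pose proof (pos_INR n); lra|exact IH].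
Qed.

(** A one-sided form of the log-convexity of Gamma: the integrand at s + x is
    t^x times the one at s, and the tangent to t^x at t = s bounds t^x by an affine
    function of t. The point s is the mean of t under the integrand at s, so
    the two terms combine to s^x v. *)
Lemma gamma_int_le s x v w : 0 < s -> 0 < x < 1 ->
  half_line_int (gamma_integrand s) v ->
  half_line_int (gamma_integrand (s + x)) w ->
  w <= Rpower s x * v.
Proof.
  intros Hs Hx Hv Hw.
  pose proof (gamma_int_S s v Hs Hv) as HS.
  set (g := fun t => Rpower s x * (1 - x) * gamma_integrand s t
                     + Rpower s x * x / s * gamma_integrand (s + 1) t).
  assert (Hg : half_line_int g (Rpower s x * v)).
  { replace (Rpower s x * v) with
      (plus (scal (Rpower s x * (1 - x)) v) (scal (Rpower s x * x / s) (s * v))).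
    2:{ unfold plus, scal; simpl; unfold mult; simpl; field; lra. }
    exact (is_RInt_gen_plus _ _ _ _ (is_RInt_gen_scal _ _ _ Hv) (is_RInt_gen_scal _ _ _ HS)). }
  apply (half_line_le (gamma_integrand (s + x)) g); [|exact Hw|exact Hg].
  intros t Ht. split; [left; apply gamma_integrand_pos|].
  unfold g. rewrite gamma_integrand_S by assumption.
  replace (gamma_integrand (s + x) t) with (Rpower t x * gamma_integrand s t).
  2:{ unfold gamma_integrand. replace (s + x - 1) with (x + (s - 1)) by ring.
      rewrite Rpower_plus; ring. }
  assert (Hu : 0 < t / s) by (apply Rdiv_lt_0_compat; lra).
  pose proof (Rpower_le_tangent (t / s) x Hu Hx) as H.
  replace (Rpower t x) with (Rpower s x * Rpower (t / s) x).
  2:{ rewrite Rpower_mult_distr by assumption. f_equal. field; lra. }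
  replace (_ + _) with (Rpower s x * (1 - x + x * (t / s)) * gamma_integrand s t) by (field; lra).
  apply Rmult_le_compat_r; [left; apply gamma_integrand_pos|].
  apply Rmult_le_compat_l; [left; apply exp_pos|exact H].
Qed.

(** Apply [gamma_int_le] between the arguments m and m + x for the upper bound,
    and between m + x and m + 1 for the lower one, with m = n + 1. *)
Lemma Gamma_bounds x n : 0 < x < 1 ->
  INR (S n) / (INR (S n) + 1)
    <= rising x (S n) * Gamma x / (INR (fact (S n)) * Rpower (INR (S n)) (x - 1)) <= 1.
Proof.
  intros Hx. set (m := INR (S n)).
  assert (Hm : 0 < m) by (apply lt_0_INR; lia).
  pose proof (gamma_int_rising x _ (S n) ltac:(lra) (gamma_int_Gamma x Hx)) as Hw.
  fold m in Hw. set (w := rising x (S n) * Gamma x) in *.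
  pose proof (gamma_int_rising 1 _ n ltac:(lra) gamma_int_1) as Hv.
  pose proof (gamma_int_rising 1 _ (S n) ltac:(lra) gamma_int_1) as Hv'.
  rewrite rising_1, Rmult_1_r in Hv, Hv'. fold m in Hv'.
  replace (1 + INR n) with m in Hv by (unfold m; rewrite S_INR; ring).
  rewrite Rplus_comm in Hw.
  pose proof (gamma_int_le m x _ _ Hm Hx Hv Hw) as Hup.
  replace (1 + m) with (m + x + (1 - x)) in Hv' by ring.
  pose proof (gamma_int_le (m + x) (1 - x) _ _ ltac:(lra) ltac:(lra) Hw Hv') as Hlo.
  rewrite fact_simpl, mult_INR in Hlo |- *. fold m in Hlo |- *.
  set (f := INR (fact n)) in *. assert (Hf : 0 < f) by apply INR_fact_lt_0.
  assert (Hp : 0 < Rpower m (x - 1)) by apply exp_pos.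
  assert (E : m * Rpower m (x - 1) = Rpower m x).
  { rewrite <- (Rpower_1 m) at 1 by assumption. rewrite <- Rpower_plus. f_equal; ring. }
  replace (m * f * Rpower m (x - 1)) with (Rpower m x * f) by (rewrite <- E; ring).
  assert (Hq : 0 < Rpower m x) by apply exp_pos.
  assert (Hd : 0 < Rpower m x * f) by nra.
  split.
  - apply (Rmult_le_reg_r (Rpower m x * f)); [assumption|].
    unfold Rdiv at 2; rewrite Rmult_assoc, Rinv_l, Rmult_1_r by lra.
    (* A base larger than 1 with an exponent below 1: drop the exponent. *)
    assert (Hr : Rpower (m + x) (1 - x) <= Rpower m (1 - x) * ((m + 1) / m)).
    { replace (m + x) with (m * ((m + x) / m)) by (field; lra).
      assert (1 < (m + x) / m).
      { apply (Rmult_lt_reg_r m); [assumption|]. unfold Rdiv; rewrite Rmult_assoc, Rinv_l; lra. }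
      rewrite <- Rpower_mult_distr by lra.
      apply Rmult_le_compat_l; [left; apply exp_pos|].
      apply Rle_trans with ((m + x) / m).
      - rewrite <- (Rpower_1 ((m + x) / m)) at 2 by lra. apply Rle_Rpower; lra.
      - apply Rmult_le_compat_r; [left; apply Rinv_0_lt_compat; lra|lra]. }
    assert (Hw0 : 0 < w).
    { assert (0 < Rpower (m + x) (1 - x)) by apply exp_pos.
      apply Rnot_le_lt; intros Hc. nra. }
    assert (Hlo2 : m * f <= Rpower m (1 - x) * ((m + 1) / m) * w).
    { apply Rle_trans with (1 := Hlo). apply Rmult_le_compat_r; lra. }
    assert (E2 : Rpower m x * Rpower m (1 - x) = m).
    { rewrite <- Rpower_plus. replace (x + (1 - x)) with 1 by ring. apply Rpower_1; assumption. }
    apply (Rmult_le_compat_l (Rpower m x / (m + 1))) in Hlo2.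
    2:{ left; apply Rdiv_lt_0_compat; lra. }
    replace (Rpower m x / (m + 1) * (Rpower m (1 - x) * ((m + 1) / m) * w))
      with ((Rpower m x * Rpower m (1 - x)) / m * w) in Hlo2 by (field; lra).
    rewrite E2 in Hlo2. replace (m / m * w) with w in Hlo2 by (field; lra).
    apply Rle_trans with (2 := Hlo2). right; field; lra.
  - apply (Rmult_le_reg_r (Rpower m x * f)); [assumption|].
    unfold Rdiv; rewrite Rmult_assoc, Rinv_l by lra. lra.
Qed.

(** * Gauss' limit formula and the closed form *)

Definition gamma_ratio (x : R) (n : nat) : R :=
  rising x n * Gamma x / (INR (fact n) * Rpower (INR n) (x - 1)).

Lemma Gamma_limit x : 0 < x < 1 -> is_lim_seq (fun n => gamma_ratio x (S n)) 1.
Proof.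
  intros Hx.
  apply (is_lim_seq_le_le (fun n => 1 - / INR (S (S n))) _ (fun _ => 1)).
  - intros n. destruct (Gamma_bounds x n Hx) as [H1 H2]. split; [|exact H2].
    apply Rle_trans with (2 := H1). right. rewrite (S_INR (S n)).
    pose proof (pos_INR (S n)). field; lra.
  - replace (Finite 1) with (Finite (1 - 0)) by (f_equal; ring).
    apply is_lim_seq_minus'; [apply is_lim_seq_const|].
    apply -> (is_lim_seq_incr_1 (fun n => / INR (S n))). apply is_lim_seq_inv_S.
  - apply is_lim_seq_const.
Qed.

Lemma Gamma_pos x : 0 < x < 1 -> 0 < Gamma x.
Proof.
  intros Hx. destruct (Gamma_bounds x 0 Hx) as [H _].
  assert (Hd : 0 < INR (fact 1) * Rpower (INR 1) (x - 1))
    by (apply Rmult_lt_0_compat; [apply INR_fact_lt_0|apply exp_pos]).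
  pose proof (rising_pos x 1 ltac:(lra)) as Hr.
  assert (Hl : 0 < INR 1 / (INR 1 + 1)) by (simpl; lra).
  apply Rnot_le_lt; intros Hg. apply (Rlt_not_le _ _ Hl), Rle_trans with (1 := H).
  apply (Rmult_le_reg_r _ _ _ Hd). unfold Rdiv.
  rewrite Rmult_assoc, Rinv_l, Rmult_0_l by lra. nra.
Qed.

(** The two Gamma arguments add up to 3/2, so the powers of n in Gauss' two
    limits multiply to 1 / sqrt n, exactly the normalisation in Wallis' limit. *)
Theorem bailey_theorem a : 0 < a < 1 ->
  hyp_half a 1 = sqrt PI / (Gamma ((1 + a) / 2) * Gamma (1 - a / 2)).
Proof.
  intros Ha. set (x := (1 + a) / 2). set (y := 1 - a / 2).
  assert (Hx : 0 < x < 1) by (unfold x; lra). assert (Hy : 0 < y < 1) by (unfold y; lra).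
  pose proof (Gamma_pos x Hx) as Gx. pose proof (Gamma_pos y Hy) as Gy.
  assert (HL : is_lim_seq (fun n => bailey_product a (S n)) (1 * 1 * sqrt PI / (Gamma x * Gamma y))).
  { apply (is_lim_seq_ext (fun n => gamma_ratio x (S n) * gamma_ratio y (S n)
      * (wallis_ratio (S n) / sqrt (INR (S n))) / (Gamma x * Gamma y))).
    - intros n. unfold gamma_ratio, bailey_product, wallis_ratio. fold x y.
      assert (Hn : 0 < INR (S n)) by (apply lt_0_INR; lia).
      set (m := INR (S n)) in *.
      assert (E : Rpower m (x - 1) * Rpower m (y - 1) * sqrt m = 1).
      { rewrite <- Rpower_sqrt, <- !Rpower_plus by assumption.
        replace (x - 1 + (y - 1) + / 2) with 0 by (unfold x, y; field).
        apply Rpower_O; assumption. }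
      pose proof (rising_neq_0 (1/2) (S n) ltac:(lra)). pose proof (INR_fact_neq_0 (S n)).
      pose proof (sqrt_lt_R0 m Hn).
      assert (0 < Rpower m (x - 1)) by apply exp_pos.
      assert (0 < Rpower m (y - 1)) by apply exp_pos.
      set (p := Rpower m (x - 1)) in *. set (q := Rpower m (y - 1)) in *.
      transitivity (rising x (S n) * rising y (S n) / (rising (1/2) (S n) * INR (fact (S n)))
        / (p * q * sqrt m)); [|rewrite E; field; split; assumption].
      field. repeat split; try assumption; lra.
    - apply is_lim_seq_div'; [|apply is_lim_seq_const|nra].
      apply is_lim_seq_mult'; [|apply wallis_ratio_limit].
      apply is_lim_seq_mult'; apply Gamma_limit; assumption. }
  pose proof (bailey_product_limit a Ha) as HB. apply is_lim_seq_incr_1 in HB.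
  apply is_lim_seq_unique in HL. apply is_lim_seq_unique in HB.
  rewrite HL in HB. injection HB as HB. rewrite <- HB. field. lra.
Qed.

(** * The quarter-integer case *)

Lemma harmonic_S n : harmonic (S n) = harmonic n + 1 / INR (S n).
Proof.
  unfold harmonic. destruct n as [|n].
  - rewrite sum_n_n, sum_n_m_zero by lia. unfold zero; simpl. ring.
  - rewrite sum_n_Sm by lia. reflexivity.
Qed.

(** The numbers 4(1/4 + j) and 4(3/4 + j) are the odd integers, and the sum
    of the reciprocals of the odd integers below 4k is H_(4k) - H_(2k) / 2. *)
Lemma dlog_quarter k : dlog_coef (1 / 4) k = 2 * (2 * harmonic (4 * k) - harmonic (2 * k)).
Proof.
  induction k as [|k IH].
  - simpl. unfold harmonic. rewrite sum_n_m_zero by lia. unfold zero; simpl; ring.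
  - replace (4 * S k)%nat with (S (S (S (S (4 * k))))) by lia.
    replace (2 * S k)%nat with (S (S (2 * k))) by lia.
    rewrite !harmonic_S. simpl dlog_coef. rewrite IH.
    rewrite !S_INR, !mult_INR. pose proof (pos_INR k). simpl (INR 4). simpl (INR 2). field. lra.
Qed.

(** Both sides are multiplied by the same rational factor when k increases,
    once the left one is written as (4k)! / (k!^2 (2k)! 128^k). *)
Lemma binomial_hyp_coef k :
  Binomial.C (2 * k) k * Binomial.C (4 * k) (2 * k) / 128 ^ k = hyp_coef (1 / 4) 1 k * (1 / 2) ^ k.
Proof.
  transitivity (INR (fact (4 * k)) / (INR (fact k) ^ 2 * INR (fact (2 * k)) * 128 ^ k)).
  { unfold Binomial.C. replace (2 * k - k)%nat with k by lia.
    replace (4 * k - 2 * k)%nat with (2 * k)%nat by lia.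
    pose proof (INR_fact_neq_0 k). pose proof (INR_fact_neq_0 (2 * k)).
    assert (128 ^ k <> 0) by (apply pow_nonzero; lra). field. auto. }
  induction k as [|k IH].
  - rewrite hyp_coef_0. simpl. field.
  - rewrite hyp_coef_S by lra.
    replace (hyp_coef (1/4) 1 k * ((1/4 + INR k) * (1 - 1/4 + INR k) / ((1 + INR k) * INR (S k))) * (1/2) ^ S k)
      with (hyp_coef (1/4) 1 k * (1/2) ^ k * ((1/4 + INR k) * (1 - 1/4 + INR k) / ((1 + INR k) * INR (S k)) * (1/2)))
      by (simpl pow; ring).
    rewrite <- IH.
    replace (4 * S k)%nat with (S (S (S (S (4 * k))))) by lia.
    replace (2 * S k)%nat with (S (S (2 * k))) by lia.
    rewrite !fact_simpl, !mult_INR, !S_INR, !mult_INR.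
    pose proof (INR_fact_neq_0 k). pose proof (INR_fact_neq_0 (2 * k)).
    assert (128 ^ k <> 0) by (apply pow_nonzero; lra).
    change (128 ^ S k) with (128 * 128 ^ k).
    pose proof (pos_INR k). simpl (INR 4). simpl (INR 2).
    field. repeat split; try assumption; lra.
Qed.

Theorem theorem1p2 :
  is_series
    (fun k : nat =>
       Binomial.C (2 * k) k * Binomial.C (4 * k) (2 * k) / 128 ^ k
       * (2 * harmonic (4 * k) - harmonic (2 * k)))
    (ln 2 * sqrt PI / (2 * Gamma (5 / 8) * Gamma (7 / 8))).
Proof.
  assert (Ha : 0 < 1 / 4 < 1) by lra.
  pose proof (is_series_scal (1 / 2) _ _ (is_series_dlog (1 / 4) Ha)) as H.
  fold (hyp_half (1 / 4) 1) in H. rewrite (bailey_theorem (1 / 4) Ha) in H.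
  replace ((1 + 1 / 4) / 2) with (5 / 8) in H by field.
  replace (1 - 1 / 4 / 2) with (7 / 8) in H by field.
  pose proof (Gamma_pos (5 / 8) ltac:(lra)). pose proof (Gamma_pos (7 / 8) ltac:(lra)).
  match type of H with is_series _ ?l =>
    assert (E : l = ln 2 * sqrt PI / (2 * Gamma (5 / 8) * Gamma (7 / 8)))
  end.
  { unfold scal; simpl; unfold mult; simpl. field. lra. }
  rewrite E in H.
  eapply is_series_ext; [|exact H].
  intros k. rewrite binomial_hyp_coef, dlog_quarter.
  unfold scal; simpl; unfold mult; simpl. field.
Qed.
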